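(* Let $k$ be a positive integer and let $G$ be a forest on $n$ vertices, of which $m$ are isolated. Then $$\alpha_k(G)\geq Z_{k+1}(G)=\frac{(n-m)(k+1)}{k+2}+m.$$
   Context: A $k$-independent set of $G$ is a set $S\subseteq V(G)$ with $\Delta(G[S])\leq k$; $\alpha_k(G)$ is the maximum cardinality of a $k$-independent set. For a vertex $v$, $\zeta(v)=\max_H\delta(H)$ over all subgraphs $H$ of $G$ containing $v$ ($\delta$ = minimum degree), and for a positive integer $r$, $Z_r(G)=\sum_{v\in V(G)}\min\{1,\frac{1}{\zeta(v)+1/r}\}$. *)

(* Defs.v *)
From HB Require Import structures.
From mathcomp Require Import all_boot all_order all_algebra.

Set Implicit Arguments.
Unset Strict Implicit.
Unset Printing Implicit Defensive.

Import Order.TTheory GRing.Theory Num.Theory.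

(* A finite simple graph G is a symmetric irreflexive relation
   e on a finite type T.  A subgraph is a pair H = (V(H), E(H)) in which every
   edge xy is stored as the two arcs (x, y) and (y, x). *)
Definition subgraph (T : finType) (e : rel T)
    (H : {set T} * {set T * T}) : bool :=
  [forall x, forall y, ((x, y) \in H.2) ==>
     [&& x \in H.1, y \in H.1, e x y & (y, x) \in H.2]].

Definition degree (T : finType) (H : {set T} * {set T * T}) (x : T) : nat :=
  #|[set y | (x, y) \in H.2]|.

(* Every degree in a subgraph of a graph on T is at most #|T|, so the default
   value #|T| is immaterial as soon as H has a vertex. *)
Definition min_degree (T : finType) (H : {set T} * {set T * T}) : nat :=
  \big[Order.min/#|T|]_(x in H.1) degree H x.

Definition max_degree (T : finType) (H : {set T} * {set T * T}) : nat :=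
  \max_(x in H.1) degree H x.

Definition induced (T : finType) (e : rel T) (S : {set T}) :
    {set T} * {set T * T} :=
  (S, [set p : T * T | [&& p.1 \in S, p.2 \in S & e p.1 p.2]]).

Definition k_independent (T : finType) (e : rel T) (k : nat) (S : {set T}) :
    bool :=
  max_degree (induced e S) <= k.

Definition alpha (T : finType) (e : rel T) (k : nat) : nat :=
  \max_(S : {set T} | k_independent e k S) #|S|.

Definition zeta (T : finType) (e : rel T) (v : T) : nat :=
  \max_(H : {set T} * {set T * T} | subgraph e H && (v \in H.1)) min_degree H.

Definition Z (T : finType) (e : rel T) (r : nat) : rat :=
  (\sum_(v : T) Num.min 1 (1 / ((zeta e v)%:R + 1 / r%:R)))%R.

(* For symmetric e, the duplicate-free cyclic sequences [:: x; y] are just the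
   edges; the genuine cycles of the graph are those of length at least 3. *)
Definition forest (T : finType) (e : rel T) : Prop :=
  forall c : seq T, ucycle e c -> size c < 3.

Definition isolated (T : finType) (e : rel T) : {set T} :=
  [set v | [forall w, ~~ e v w]].

(* Main.v *)
Require Import Defs.
From mathcomp Require Import all_boot all_order all_algebra.
From mathcomp Require Import zify ring lra.

Import Order.TTheory GRing.Theory Num.Theory.
Local Open Scope ring_scope.

(** Every nonempty vertex set of a forest induces a vertex of degree at most 1.
    Hence [zeta] is 0 on isolated vertices and 1 on the others, and the vertices
    can be ordered so that each has at most one later neighbour, its parent.
    It remains to delete at most |A| / (k + 2) vertices from the set A of
    non-isolated vertices so that all degrees drop to at most k.  Let v be the
    first vertex of degree at least k + 1 in A.  Delete v if it has at least
    k + 1 children, and otherwise its parent p; then recurse on A without v, its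
    children, and, in the second case, p.  At least k + 2 vertices are
    discarded for one deletion.  Vertices preceding v already have degree at
    most k, and vertices following v have no surviving neighbour among the
    discarded ones. *)

(** * Degrees in induced subgraphs and orderings of forests *)

Definition nbhd {T : finType} (e : rel T) (A : {set T}) (x : T) : {set T} :=
  [set y in A | e x y].

Lemma nbhdS (T : finType) (e : rel T) (A B : {set T}) (x : T) :
  A \subset B -> (#|nbhd e A x| <= #|nbhd e B x|)%N.
Proof.
move=> sAB; apply/subset_leq_card/subsetP => y; rewrite !inE => /andP[yA ->].
by rewrite (subsetP sAB).
Qed.

Lemma degree_induced (T : finType) (e : rel T) (S : {set T}) (x : T) :
  x \in S -> degree (induced e S) x = #|nbhd e S x|.
Proof. by move=> xS; apply: eq_card => y; rewrite !inE /= xS. Qed.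

Lemma k_independentP (T : finType) (e : rel T) (k : nat) (S : {set T}) :
  reflect {in S, forall x, #|nbhd e S x| <= k}%N (k_independent e k S).
Proof.
apply: (iffP (bigmax_leqP _ _ _)) => H x xS.
  by rewrite -degree_induced ?H.
by rewrite degree_induced ?H.
Qed.

(** Otherwise a duplicate-free path in [A] could be prolonged at its head [x] forever: [x] has a
    neighbour other than its successor on the path, and if that neighbour were already on the path
    it would close a cycle. *)
Lemma forest_low_degree (T : finType) (e : rel T) (A : {set T}) :
  symmetric e -> irreflexive e -> forest e -> A != set0 ->
  exists2 x, x \in A & (#|nbhd e A x| <= 1)%N.
Proof.
move=> e_sym e_irr e_forest /set0Pn[x0 x0A].
case: (pickP [pred x in A | #|nbhd e A x| <= 1]%N) => [x /andP[]|Adeg].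
  by exists x.
have long_path l : exists x p,
    [/\ size p = l, path e x p, uniq (x :: p) & {subset x :: p <= A}].
  elim: l => [|l [x [p [sz_p pth_p uniq_p subA]]]].
    by exists x0, [::]; split=> // y; rewrite inE => /eqP->.
  have xA : x \in A by apply: subA; rewrite mem_head.
  have /card_gt0P[y] : (0 < #|nbhd e A x :\ head x p|)%N.
    have := Adeg x; rewrite /= xA (cardsD1 (head x p)) /=; lia.
  rewrite !inE => /and3P[y_head yA e_xy].
  have [|y_new] := boolP (y \in x :: p); last first.
    exists y, (x :: p); split; rewrite /= ?sz_p //.
    - by rewrite e_sym e_xy.
    - by rewrite y_new.
    - by move=> z; rewrite inE => /predU1P[->|/subA].
  rewrite inE => /predU1P[eq_yx|y_p]; first by rewrite eq_yx e_irr in e_xy.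
  case/splitPr: y_p y_head pth_p uniq_p {subA sz_p} => p1 p2 y_head.
  rewrite -cat_rcons -cat_cons cat_uniq cat_path rcons_path.
  move=> /andP[/andP[pth_p1 e_last] _] /andP[uniq_c _].
  have /e_forest : ucycle e (x :: rcons p1 y).
    rewrite /ucycle uniq_c /= !rcons_path last_rcons pth_p1 e_last.
    by rewrite e_sym e_xy.
  (* If [p1] is empty, [y] is the successor of [x], which was excluded; otherwise the cycle has at
     least three vertices. *)
  case: p1 y_head {pth_p1 e_last uniq_c} => [|z p1] //=; first by rewrite eqxx.
  by rewrite size_rcons.
have [x [p [sz_p _ /card_uniqP card_p _]]] := long_path #|T|.
by have := max_card (mem (x :: p)); rewrite card_p /= sz_p ltnn.
Qed.

(** Vertices of degree at most 1 are peeled off one by one, and [f] is the order of removal: the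
    neighbours remaining at that moment are the later ones. *)
Lemma forest_order (T : finType) (e : rel T) :
  symmetric e -> irreflexive e -> forest e ->
  exists2 f : T -> nat, injective f &
    forall x y z, e x y -> e x z -> (f x < f y)%N -> (f x < f z)%N -> y = z.
Proof.
move=> e_sym e_irr e_forest.
suff: forall (l : nat) (A : {set T}), #|A| = l ->
  exists2 f : T -> nat, {in A &, injective f} &
    {in A & &, forall x y z,
      e x y -> e x z -> (f x < f y)%N -> (f x < f z)%N -> y = z}.
  move=> /(_ _ setT erefl)[f f_inj f_par]; exists f => [x y|x y z].
    by apply: f_inj; rewrite inE.
  by apply: f_par; rewrite inE.
elim=> [|l IH] A.
  by move/cards0_eq->; exists (fun=> 0%N) => [x|x] ?; rewrite inE.
move=> cardA; have A_neq0 : A != set0 by rewrite -card_gt0 cardA.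
have [x0 x0A deg_x0] := forest_low_degree _ _ _ e_sym e_irr e_forest A_neq0.
have [|f f_inj f_par] := IH (A :\ x0).
  by move: cardA; rewrite (cardsD1 x0) x0A => -[].
pose g x := if x == x0 then 0%N else (f x).+1.
exists g => [x y xA yA|x y z xA yA zA]; rewrite /g.
  have [-> | x_neq] := eqVneq x x0; have [-> | y_neq] := eqVneq y x0 => //.
  by case=> /f_inj; apply; rewrite !inE ?x_neq ?y_neq.
have [-> | x_neq] := eqVneq x x0.
  move=> e_xy e_xz _ _; move/card_le1_eqP: deg_x0; apply; rewrite inE;
    by [rewrite yA|rewrite zA].
have [//|y_neq] := eqVneq y x0; have [//|z_neq] := eqVneq z x0.
by rewrite !ltnS; apply: f_par; rewrite !inE ?x_neq ?y_neq ?z_neq.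
Qed.

(** * Bounding all degrees by few deletions *)

Lemma forest_deletion (T : finType) (e : rel T) (k : nat) (A : {set T}) :
  symmetric e -> irreflexive e -> forest e ->
  exists D : {set T}, (#|D| * k.+2 <= #|A|)%N /\ k_independent e k (A :\: D).
Proof.
move=> e_sym e_irr e_forest.
have [f f_inj f_par] := forest_order _ _ e_sym e_irr e_forest.
have [l] := ubnP #|A|; elim: l A => // l IH A /ltnSE le_Al.
case: (pickP [pred x in A | k < #|nbhd e A x|]%N) =>
  [w w_big|small]; last first.
  exists set0; rewrite cards0; split=> //; apply/k_independentP => x.
  by rewrite setD0 => xA; have := small x; rewrite /= xA ltnNge => /negbFE.
case: (arg_minnP f w_big) => v /andP[vA v_big] v_min.
have early u : u \in A -> (f u < f v)%N -> (#|nbhd e A u| <= k)%N.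
  move=> uA lt_uv; rewrite leqNgt; apply/negP => u_big.
  by have := v_min u; rewrite inE uA u_big => /(_ isT); rewrite leqNgt lt_uv.
(* The children of [v]: each has [v] as its only later neighbour. *)
pose C := [set y in nbhd e A v | f y < f v]%N.
have inC y : (y \in C) = [&& y \in A, e v y & f y < f v]%N.
  by rewrite !inE andbA.
have vC : v \notin C by rewrite inC ltnn !andbF.
have later_child u c : c \in C -> (f v < f u)%N -> ~~ e u c.
  rewrite inC => /and3P[_ e_vc lt_cv] lt_vu; apply/negP => e_uc.
  have eq_uv : u = v.
    by apply: (f_par c); rewrite 1?e_sym // (ltn_trans lt_cv).
  by rewrite eq_uv ltnn in lt_vu.
have lt_neq u : u != v -> (f v <= f u)%N -> (f v < f u)%N.
  move=> u_neq; rewrite leq_eqVlt => /predU1P[/f_inj eq_vu|//].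
  by rewrite eq_vu eqxx in u_neq.
(* [N] is the discarded set and [x] its only deleted vertex. *)
suff [N [x [xN sNA cardN v_ok late_ok]]] : exists (N : {set T}) (x : T),
    [/\ x \in N, N \subset A, (k.+2 <= #|N|)%N,
        v = x \/ (#|nbhd e (A :\ x) v| <= k)%N &
        forall u, (f v < f u)%N -> u != x ->
          u \notin N /\ forall c, c \in N -> e u c -> c = x].
  have cardAN : #|A :\: N| = (#|A| - #|N|)%N.
    by rewrite cardsD (setIidPr sNA).
  have leNA := subset_leq_card sNA.
  have [|D [cardD /k_independentP D_ok]] := IH (A :\: N); first lia.
  exists (x |: D); split.
    have : (#|x |: D| <= #|D|.+1)%N by rewrite cardsU1; case: (_ \notin _).
    nia.
  apply/k_independentP => u.
  rewrite !inE negb_or => /andP[/andP[u_neq uD] uA].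
  (* Only a vertex [u] after [v] needs the recursive bound: its sole possible neighbour in [N] is
     the deleted [x], so its surviving neighbours all lie in [A :\: N]. *)
  have [lt_uv|le_vu] := ltnP (f u) (f v).
    by apply: leq_trans (early u uA lt_uv); apply/nbhdS/subsetDl.
  have [eq_uv|/lt_neq/(_ le_vu) lt_vu] :=
    eqVneq u v.
    case: v_ok => [eq_vx|]; first by rewrite eq_uv eq_vx eqxx in u_neq.
    rewrite eq_uv; apply/leq_trans/nbhdS/setDS.
    by rewrite sub1set setU11.
  have [uN late] := late_ok u lt_vu u_neq.
  apply: leq_trans (D_ok u _); last by rewrite !inE uD uN.
  apply/subset_leq_card/subsetP => y.
  rewrite !inE negb_or => /andP[/andP[/andP[y_neq yD] yA] e_uy].
  rewrite yD yA e_uy !andbT; apply/negP => /late/(_ e_uy) eq_yx.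
  by rewrite eq_yx eqxx in y_neq.
have [C_big|C_small] := ltnP k #|C|.
  exists (v |: C), v; split; rewrite ?setU11 ?cardsU1 ?vC //; last 2 first.
  - by left.
  - move=> u lt_vu u_neq; split.
      by rewrite in_setU1 inC (negPf u_neq) (ltnNge (f u)) (ltnW lt_vu) !andbF.
    move=> c; rewrite in_setU1 => /predU1P[//|].
    by move/later_child/(_ lt_vu)/negPf->.
  - by apply/subsetP => y; rewrite in_setU1 inC => /predU1P[->|/and3P[]].
(* With at most [k] children but more than [k] neighbours, [v] has a parent [p]. It is the only
   non-child neighbour, so there are exactly [k] children and deleting [p] suffices for [v]. *)
have /card_gt0P[p] : (0 < #|nbhd e A v :\: C|)%N.
  have := cardsID C (nbhd e A v).
  have := subset_leq_card (subsetIr (nbhd e A v) C); lia.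
rewrite in_setD inC !inE => /andP[] /[swap] /andP[pA e_vp].
rewrite pA e_vp /= -leqNgt => le_vp.
have p_neq : p != v by apply/eqP => eq_pv; rewrite eq_pv e_irr in e_vp.
have lt_vp := lt_neq p p_neq le_vp.
have pC : p \notin C by rewrite inC (ltnNge (f p)) le_vp !andbF.
have nbhd_v : nbhd e A v = p |: C.
  apply/setP => y; rewrite in_setU1 inC inE.
  have [->|y_neq] := eqVneq y p; first by rewrite pA e_vp.
  case yA: (y \in A) => //=; case e_vy: (e v y) => //=.
  have y_neqv : y != v by apply/eqP => eq_yv; rewrite eq_yv e_irr in e_vy.
  symmetry; rewrite ltnNge; apply/negP => /(lt_neq y y_neqv) lt_vy.
  by rewrite (f_par v y p) ?eqxx in y_neq.
have cardC : #|C| = k.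
  by have := v_big; rewrite nbhd_v cardsU1 pC; lia.
exists (p |: (v |: C)), p; split; first exact: setU11.
- apply/subsetP => y; rewrite !in_setU1 inC.
  by move=> /predU1P[->//|/predU1P[->//|/and3P[]]].
- by rewrite !cardsU1 in_setU1 negb_or p_neq pC vC cardC.
- right; rewrite -cardC; apply/subset_leq_card/subsetP => y.
  rewrite !inE => /andP[/andP[y_neq yA] e_vy].
  have : y \in nbhd e A v by rewrite inE yA.
  rewrite nbhd_v in_setU1 (negPf y_neq) inC => /and3P[_ _ ->].
  by rewrite yA e_vy.
move=> u lt_vu u_neq; split.
  rewrite !in_setU1 inC (negPf u_neq) (ltnNge (f u)) (ltnW lt_vu) !andbF orbF.
  by apply: contraTneq lt_vu => ->; rewrite ltnn.
move=> c; rewrite !in_setU1 => /predU1P[//|/predU1P[->|cC]] e_uc; last first.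
  by rewrite (negPf (later_child u c cC lt_vu)) in e_uc.
by rewrite (f_par v u p) ?eqxx // 1?e_sym in u_neq.
Qed.

(** * The values of [zeta] and [Z] on a forest *)

Lemma min_degree_le (T : finType) (H : {set T} * {set T * T}) (x : T) :
  x \in H.1 -> (min_degree H <= degree H x)%N.
Proof. by move=> xH; rewrite -leEnat; apply: bigmin_le_cond. Qed.

Lemma degree_subgraph (T : finType) (e : rel T) (H : {set T} * {set T * T})
    (x : T) :
  subgraph e H -> (degree H x <= #|nbhd e H.1 x|)%N.
Proof.
move=> /forallP/(_ x)/forallP sub; apply/subset_leq_card/subsetP => y.
by rewrite !inE => xy; have /implyP/(_ xy)/and4P[_ -> ->] := sub y.
Qed.

Lemma subgraph_induced (T : finType) (e : rel T) (S : {set T}) :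
  symmetric e -> subgraph e (induced e S).
Proof.
move=> e_sym; apply/forallP => x; apply/forallP => y; apply/implyP.
by rewrite !inE /= => /and3P[-> -> e_xy]; rewrite e_xy e_sym e_xy.
Qed.

(** The upper bound 1 comes from a low-degree vertex of the vertex set of [H]; a single edge at [v]
    attains it. *)
Lemma zeta_forest (T : finType) (e : rel T) (v : T) :
  symmetric e -> irreflexive e -> forest e ->
  zeta e v = (v \notin isolated e) :> nat.
Proof.
move=> e_sym e_irr e_forest; apply/eqP; rewrite eqn_leq; apply/andP; split.
  apply/bigmax_leqP => H /andP[subH vH].
  have [|_] := boolP (v \in isolated e).
    rewrite inE => /forallP v_iso; apply: leq_trans (min_degree_le _ _ _ vH) _.
    apply: leq_trans (degree_subgraph _ _ _ v subH) _; rewrite leqn0 cards_eq0.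
    by apply/eqP/setP => y; rewrite !inE (negPf (v_iso y)) andbF.
  have [|x xH deg_x] := @forest_low_degree T e H.1 e_sym e_irr e_forest.
    by apply/set0Pn; exists v.
  apply: leq_trans (min_degree_le _ _ _ xH) _.
  exact: leq_trans (degree_subgraph _ _ _ x subH) deg_x.
have [//|] := boolP (v \in isolated e).
rewrite inE negb_forall => /existsP[w]; rewrite negbK => e_vw.
pose H := induced e [set v; w].
have subH : subgraph e H && (v \in H.1).
  by rewrite subgraph_induced // !inE eqxx.
rewrite /zeta (bigD1 H subH) /= leq_max; apply/orP; left.
rewrite -leEnat; apply/bigmin_geP; split.
  (* The default value [#|T|] of the minimum must also be at least 1. *)
  by apply/card_gt0P; exists v.
move=> x xH; rewrite leEnat degree_induced //; apply/card_gt0P.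
move: xH; rewrite !inE => /orP[]/eqP->.
  by exists w; rewrite !inE eqxx orbT.
by exists v; rewrite !inE eqxx e_sym.
Qed.

Lemma Z_forest (T : finType) (e : rel T) (k : nat) :
  symmetric e -> irreflexive e -> forest e ->
  Z e k.+1 = (#|T|%:R - #|isolated e|%:R) * (k%:R + 1) / (k%:R + 2)
             + #|isolated e|%:R.
Proof.
move=> e_sym e_irr e_forest; have k_ge0 : 0 <= k%:R :> rat := ler0n _ _.
rewrite /Z (bigID [in isolated e]) /= addrC; congr (_ + _).
  under eq_bigr => v v_iso.
    rewrite zeta_forest // v_iso mulr1n.
    rewrite (_ : Num.min _ _ = (k%:R + 1) / (k%:R + 2)).
      over.
    rewrite -natr1 (_ : 1 / _ = (k%:R + 1) / (k%:R + 2)).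
      by apply/min_idPr; rewrite ler_pdivrMr; lra.
    by field; rewrite !lt0r_neq0 //=; lra.
  rewrite -mulrA big_const iter_addr_0 -[LHS]mulr_natl -natrB ?max_card //.
  by congr (_%:R * _); rewrite -(cardC [in isolated e]) addKn.
(* For [zeta] equal to 0 the quotient is [k + 1], which the minimum truncates to 1. *)
under eq_bigr => v v_iso.
  rewrite zeta_forest // v_iso (_ : Num.min _ _ = 1); first over.
  apply/min_idPl; rewrite add0r !div1r invrK -natr1; lra.
by rewrite big_const iter_addr_0.
Qed.

Theorem theorem8 (k n m : nat) (T : finType) (e : rel T)
  (k_gt0 : (0 < k)%N)
  (e_sym : symmetric e) (e_irr : irreflexive e) (e_forest : forest e)
  (card_n : #|T| = n) (card_m : #|isolated e| = m) :
  Z e k.+1 <= (alpha e k)%:R /\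
  Z e k.+1 = (n%:R - m%:R) * (k%:R + 1) / (k%:R + 2) + m%:R.
Proof.
have Z_eq := Z_forest _ _ k e_sym e_irr e_forest.
rewrite card_n card_m in Z_eq; split=> //; rewrite Z_eq.
have [D [cardD /k_independentP D_ok]] :=
  forest_deletion _ _ k (~: isolated e) e_sym e_irr e_forest.
have indep : k_independent e k (~: D).
  apply/k_independentP => x; rewrite inE => xD.
  (* Isolated vertices are nobody's neighbours, so putting them back raises no degree. *)
  have sub_nbhd : nbhd e (~: D) x \subset nbhd e (~: isolated e :\: D) x.
    apply/subsetP => y; rewrite !inE => /andP[-> e_xy]; rewrite e_xy andbT.
    by apply/forallPn; exists x; rewrite negbK e_sym.
  have [->|/set0Pn[y]] := eqVneq (nbhd e (~: D) x) set0.
    by rewrite cards0.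
  rewrite inE => /andP[_ e_xy].
  apply: leq_trans (subset_leq_card sub_nbhd) (D_ok x _).
  by rewrite !inE xD; apply/forallPn; exists y; rewrite negbK.
have le_alpha : (#|~: D| <= alpha e k)%N.
  by rewrite /alpha (bigD1 (~: D) indep) leq_maxl.
(* Since [#|D| * (k + 2)] is at most [n - m], the product [(n - #|D|) * (k + 2)] is at least
   [n * (k + 2) - (n - m)], which is the left-hand side. *)
have key : ((n - m) * (k + 1) + m * (k + 2) <= alpha e k * (k + 2))%N.
  have := cardsC D; have := cardsC (isolated e).
  rewrite card_n card_m; nia.
have le_mn : (m <= n)%N by rewrite -card_n -card_m max_card.
have pos : 0 < k%:R + 2 :> rat by rewrite ltr_wpDl.
rewrite -(ler_pM2r pos) mulrDl divfK ?lt0r_neq0 //.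
by move: key; rewrite -(ler_nat rat) !(natrD, natrM) natrB.
Qed.
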